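(* Let $V$ be the metric space obtained by gluing in a chain the vertex sets $V_n$ of the graphs $\Gamma_n$ with metrics multiplied by $n$, for $n=1,2,3,\dots$, as defined in the context. Then $V$ has bounded geometry, and $V$ does not admit a quasi-isometric embedding into any round ball space; that is, for every round ball space $Y$ there is no map $f\colon V\to Y$ for which there exist constants $L>0$ and $C\ge 0$ with $$L^{-1}d_V(x,y)-C\le d_Y(f(x),f(y))\le L\,d_V(x,y)+C\qquad\text{for all }x,y\in V.$$
   Context: The graphs $\Gamma_n$. $\Gamma_0$ is a single edge of length $1$; its two endpoints form its pair of primary vertices. Given $\Gamma_n$, take four copies of it, indexed by $i=0,1,2,3$; in the $i$-th copy let $p_i,q_i$ be a pair of primary vertices, i.e. a pair of vertices of valence $2^n$ in $\Gamma_n$ at distance $2^n$ from each other (the same pair in each copy). $\Gamma_{n+1}$ is obtained by identifying $q_i$ with $p_{i+1}$ for all $i$ modulo $4$, and is equipped with the path metric. (So $\Gamma_1$ is a 4-cycle; for $n\ge 1$, $\Gamma_n$ has exactly two pairs of primary vertices, namely the two pairs of opposite vertices among the four gluing vertices, and $\operatorname{diam}\Gamma_n=2^n$.) The space $V$. For $n\ge1$ let $V_n$ be the vertex set of $\Gamma_n$ with the metric $d_{V_n}=n\cdot d_{\Gamma_n}$, and let $p_n,q_n$ be a pair of primary vertices of $\Gamma_n$. $V$ is obtained from the disjoint union of the $V_n$ by identifying $q_n$ with $p_{n+1}$ for every $n\ge 1$; its metric restricts to $d_{V_n}$ on $V_n$, and for $x\in V_m$, $y\in V_n$ with $m<n$,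 $d_V(x,y)=d_{V_m}(x,q_m)+\sum_{m<k<n}k2^k+d_{V_n}(p_n,y)$. Bounded geometry (for such a discrete space): for every $r>0$ there is $N(r)\in\mathbb{N}$ such that every ball of radius $r$ in $V$ contains at most $N(r)$ points. Round ball space: a metric space $(Y,d)$ such that for every $\varepsilon>0$ there exists $\delta_\varepsilon>0$ with $$\operatorname{diam}\left(B\left(x,\tfrac{1+\delta_\varepsilon}{2}d(x,y)\right)\cap B\left(y,\tfrac{1+\delta_\varepsilon}{2}d(x,y)\right)\right)<\varepsilon\, d(x,y)$$ for all distinct $x,y\in Y$, where $B(x,r)$ is the closed ball of radius $r$ about $x$ (using open balls gives an equivalent definition). *)

(* Defs.v *)
From HB Require Import structures.
From mathcomp Require Import all_boot all_order all_algebra.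
From mathcomp Require Import zify.

Set Implicit Arguments.
Unset Strict Implicit.
Unset Printing Implicit Defensive.

Import Order.TTheory GRing.Theory Num.Theory.

Record sgraph := SGraph {
  vertex :> finType;
  adj : rel vertex;
  adj_sym : symmetric adj;
  adj_irr : irreflexive adj }.

Section GraphMetric.
Variable G : sgraph.
Implicit Types x y : G.

Definition valence x : nat := #|[set y | adj x y]|%N.

Definition has_walk x y (k : nat) : bool :=
  [exists s : k.-tuple G, path (@adj G) x s && (last x s == y)].

(* Least length of a walk from x to y. A shortest walk has fewer than #|G|
   edges; the junk value #|G| is only taken when x and y are not connected. *)
Definition gdist x y : nat := find (has_walk x y) (iota 0 #|G|).

Definition primary (n : nat) x y : Prop :=
  [/\ valence x = 2 ^ n, valence y = 2 ^ n & gdist x y = 2 ^ n]%N.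

End GraphMetric.

Section SingleEdge.

Let adjK2 : rel bool := fun a b => a != b.

Fact adjK2_sym : symmetric adjK2.
Proof. by move=> a b; rewrite /adjK2 eq_sym. Qed.

Fact adjK2_irr : irreflexive adjK2.
Proof. by move=> a; rewrite /adjK2 eqxx. Qed.

Definition K2 : sgraph := SGraph adjK2_sym adjK2_irr.

End SingleEdge.

(* Four copies of G in a cycle, q in copy i being identified with p in copy
   i + 1 mod 4. For p != q each class has exactly one representative (i, v) with
   v != q, so these representatives are taken as the vertices; cyc4_repr sends
   a vertex of the disjoint union to the representative of its class. *)
Section FourCycle.
Variables (G : sgraph) (p q : G).

Definition cyc4_vertex : finType := {x : 'I_4 * G | x.2 != q}.

Definition cyc4_repr (x : 'I_4 * G) : 'I_4 * G :=
  if x.2 == q then (ordS x.1, p) else x.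

Definition cyc4_adj : rel cyc4_vertex := fun x y =>
  [exists i : 'I_4, exists u : G, exists v : G,
    [&& adj u v, cyc4_repr (i, u) == val x & cyc4_repr (i, v) == val y]].

Fact cyc4_adj_sym : symmetric cyc4_adj.
Proof.
suff sub x y : cyc4_adj x y -> cyc4_adj y x by move=> x y; apply/idP/idP; exact: sub.
case/existsP=> i /existsP[u /existsP[v /and3P[uv ux vy]]].
apply/existsP; exists i; apply/existsP; exists v; apply/existsP; exists u.
by rewrite adj_sym uv vy ux.
Qed.

Fact cyc4_adj_irr : irreflexive cyc4_adj.
Proof.
move=> x; apply/negbTE/negP=> /existsP[i /existsP[u /existsP[v /and3P[uv /eqP<-]]]].
have neS : (ordS i == i) = false by case: i => -[|[|[|[|]]]].
rewrite /cyc4_repr /=; case: (eqVneq u q) => [uq|uq]; case: (eqVneq v q) => [vq|vq].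
- by move: uv; rewrite uq vq adj_irr.
- by rewrite xpair_eqE eq_sym neS.
- by rewrite xpair_eqE neS.
- by rewrite xpair_eqE eqxx => /= /eqP vu; move: uv; rewrite vu adj_irr.
Qed.

Definition cyc4 : sgraph := SGraph cyc4_adj_sym cyc4_adj_irr.

End FourCycle.

(* is_Gamma n G: G is the graph Gamma_n, for some choice of a pair of primary
   vertices at each step of the construction. *)
Inductive is_Gamma : nat -> sgraph -> Prop :=
| is_Gamma0 : is_Gamma 0 K2
| is_GammaS n (G : sgraph) (p q : G) :
    is_Gamma n G -> primary n p q -> is_Gamma n.+1 (cyc4 p q).

(* The graphs Gamma_n and their pairs of primary vertices exist. The function h
   of inv gives the lower bound on the distance from p to q. *)
Module GammaExistence.
Local Open Scope nat_scope.

Definition inv n (G : sgraph) (p q : G) :=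
  [/\ valence p = 2 ^ n, valence q = 2 ^ n,
      exists s, [/\ path (@adj G) p s, last p s = q & size s = 2 ^ n] &
      exists h : G -> nat, [/\ h p = 0, h q = 2 ^ n, forall v, h v <= 2 ^ n &
        forall u v, adj u v -> h v <= (h u).+1]].

Lemma lip_path (G : sgraph) (h : G -> nat) (x : G) s :
  (forall u v, adj u v -> h v <= (h u).+1) -> path (@adj G) x s ->
  h (last x s) <= h x + size s.
Proof.
move=> lip; elim: s x => [|y s IH] x /=; first by rewrite addn0.
by case/andP=> /lip xy /IH; lia.
Qed.

Lemma inv_primary n (G : sgraph) (p q : G) : inv n p q -> primary n p q.
Proof.
case=> vp vq [s [ps ls ss]] [h [hp hq _ lip]]; split=> //.
have low k : has_walk p q k -> 2 ^ n <= k.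
  case/existsP=> t /andP[pt /eqP lt]; have := lip_path lip pt.
  by rewrite lt hp hq size_tuple.
have hw : has_walk p q (2 ^ n).
  apply/existsP; have sz : size s == 2 ^ n by rewrite ss.
  by exists (Tuple sz); rewrite /= ps ls eqxx.
have lt : 2 ^ n < #|G|.
  move: ls; case/shortenP: ps => s' ps' us' _ ls.
  have := lip_path lip ps'; rewrite ls hp hq add0n => le.
  apply: leq_ltn_trans le _.
  by rewrite -[_.+1]/(size (p :: s')) -(card_uniqP us') max_card.
rewrite /gdist; apply/eqP; rewrite eqn_leq; apply/andP; split.
  rewrite leqNgt; apply/negP=> /(before_find 0).
  by rewrite nth_iota // add0n hw.
apply: low.
have hs : has (has_walk p q) (iota 0 #|G|).
  by apply/hasP; exists (2 ^ n) => //; rewrite mem_iota.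
have := nth_find 0 hs; rewrite nth_iota //.
by move: hs; rewrite has_find size_iota.
Qed.

Lemma inv0 : @inv 0 K2 false true.
Proof.
split.
- rewrite /valence (_ : [set y | _] = [set true]) ?cards1 //.
  by apply/setP=> -[]; rewrite !inE.
- rewrite /valence (_ : [set y | _] = [set false]) ?cards1 //.
  by apply/setP=> -[]; rewrite !inE.
- by exists [:: true].
- by exists (fun b : bool => nat_of_bool b); split=> // -[] // [].
Qed.

Section Step.
Variables (n : nat) (G : sgraph) (p q : G).
Variable I : inv n p q.
Lemma pq : p != q.
Proof. by case: I => _ _ _ [h [hp hq _ _]]; apply/eqP=> e; move: hq; rewrite -e hp; have := expn_gt0 2 n; lia. Qed.
Lemma repr_ok x : (cyc4_repr p q x).2 != q.
Proof. by rewrite /cyc4_repr; case: ifPn => //= _; apply: pq. Qed.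
Definition pr i v : cyc4 p q := Sub (cyc4_repr p q (i, v)) (repr_ok (i, v)).
Lemma pr_adj i u v : adj u v -> adj (pr i u) (pr i v).
Proof.
move=> uv; apply/existsP; exists i; apply/existsP; exists u; apply/existsP; exists v.
by rewrite uv !eqxx.
Qed.
Lemma adjP (x y : cyc4 p q) : adj x y -> exists i u v, [/\ adj u v, x = pr i u & y = pr i v].
Proof.
case/existsP=> i /existsP[u /existsP[v /and3P[uv /eqP ux /eqP vy]]].
by exists i, u, v; split=> //; apply: val_inj.
Qed.
Lemma pr_q i : pr i q = pr (ordS i) p.
Proof. by apply: val_inj; rewrite /= /cyc4_repr /= eqxx (negbTE pq). Qed.
Lemma pr_path i x s : path (@adj G) x s -> path (@adj (cyc4 p q)) (pr i x) (map (pr i) s).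
Proof. by elim: s x => //= y s IH x /andP[xy ys]; apply/andP; split; [exact: (pr_adj i xy)|exact: IH]. Qed.
Lemma pr_inj i : injective (pr i).
Proof.
have neS : (ordS i == i) = false by case: i => -[|[|[|[|]]]].
move=> u v /(congr1 val); rewrite /= /cyc4_repr /=.
case: (eqVneq u q) => [->|_]; case: (eqVneq v q) => [->|_] //.
- by move/(congr1 fst)/eqP; rewrite /= neS.
- by move/(congr1 fst)/eqP; rewrite /= eq_sym neS.
- by case.
Qed.
Lemma val_glue i : valence (pr (ordS i) p) = 2 ^ n.+1.
Proof.
case: I => vp vq _ _.
have neS (j : 'I_4) : (ordS j == j) = false by case: j => -[|[|[|[|]]]].
have neSS (j : 'I_4) : (ordS (ordS j) == j) = false by case: j => -[|[|[|[|]]]].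
have inS : injective (@ordS 4) by apply: ordS_inj.
rewrite /valence (_ : [set y | _] = (pr (ordS i) @: [set v | adj p v]) :|: (pr i @: [set v | adj q v])); last first.
  apply/setP=> y; rewrite !inE; apply/idP/orP.
    case/adjP=> j [u [v [uv e ->]]].
    have := congr1 val e; rewrite /= /cyc4_repr /= (negbTE pq).
    case: (eqVneq u q) => uq E.
      have := congr1 fst E => /= /inS ->; right; apply: imset_f; by rewrite inE -uq.
    have /= -> := congr1 fst E; left; apply: imset_f; rewrite inE.
    by have /= -> := congr1 snd E.
  case=> /imsetP[v]; rewrite inE => av ->; first exact: pr_adj.
  by rewrite -pr_q; exact: pr_adj.
rewrite cardsU !card_imset; try exact: pr_inj.
rewrite -/(valence p) -/(valence q) vp vq (_ : _ :&: _ = set0) ?cards0 ?expnS; first lia.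
apply/setP=> y; rewrite !inE; apply/negbTE/negP=> /andP[/imsetP[u]].
rewrite inE => pu -> /imsetP[v]; rewrite inE => qv /(congr1 val).
rewrite /= /cyc4_repr /=.
have nvq : v == q = false by apply/eqP=> e; move: qv; rewrite e adj_irr.
have nup : u == p = false by apply/eqP=> e; move: pu; rewrite e adj_irr.
by rewrite nvq; case: (u == q) => /(congr1 fst)/eqP; rewrite /= ?neSS ?neS.
Qed.
Let i0 : 'I_4 := @Ordinal 4 0 isT.
Let i1 : 'I_4 := @Ordinal 4 1 isT.
Let i2 : 'I_4 := @Ordinal 4 2 isT.
Let i3 : 'I_4 := @Ordinal 4 3 isT.
Lemma inv_step : inv n.+1 (pr i0 p) (pr i2 p).
Proof.
have e0 : i0 = ordS i3 by apply: val_inj.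
have e1 : i1 = ordS i0 by apply: val_inj.
have e2 : i2 = ordS i1 by apply: val_inj.
split.
- by rewrite e0 val_glue.
- by rewrite e2 val_glue.
- case: I => _ _ [s [ps ls ss]] _.
  exists (map (pr i0) s ++ map (pr i1) s).
  rewrite cat_path pr_path // last_cat !last_map ls pr_q -e1 pr_path // last_map ls pr_q -e2.
  by split=> //; rewrite size_cat !size_map ss expnS; lia.
case: I => _ _ _ [h [hp hq hle lip]].
pose h' (x : 'I_4 * G) := match nat_of_ord x.1 with
  | 0 => h x.2 | 1 => 2 ^ n + h x.2 | 2 => 2 ^ n.+1 - h x.2 | _ => 2 ^ n - h x.2 end.
have h'r x : h' (cyc4_repr p q x) = h' x.
  rewrite /cyc4_repr; case: eqP => // e.
  case: x e => -[[|[|[|[|]]]] // lt] v /= ->; rewrite /h' /= hq hp ?expnS; lia.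
exists (fun x => h' (val x)); split.
- by rewrite [val _]/= h'r.
- by rewrite [val _]/= h'r /h' /= hp; lia.
- move=> x; rewrite /h' expnS; have := hle (val x).2.
  by case: (nat_of_ord _) => [|[|[|?]]] /=; lia.
- move=> x y /adjP[i [u [v [uv -> ->]]]]; rewrite ![val _]/= !h'r /h' /= expnS.
  have := lip _ _ uv; have := hle v; have := hle u.
  have := lip v u; rewrite adj_sym => /(_ uv).
  by case: (nat_of_ord _) => [|[|[|?]]] /=; lia.
Qed.
End Step.

Lemma Gamma_exists n : exists (G : sgraph) (p q : G), is_Gamma n G /\ primary n p q.
Proof.
suff: exists (G : sgraph) (p q : G), is_Gamma n G /\ inv n p q.
  by case=> G [p [q [? /inv_primary ?]]]; exists G, p, q.
elim: n => [|n [G [p [q [GG I]]]]].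
  by exists K2, false, true; split; [constructor|exact: inv0].
exists (cyc4 p q), (pr I (@Ordinal 4 0 isT) p), (pr I (@Ordinal 4 2 isT) p).
by split; [constructor=> //; exact: inv_primary | exact: inv_step].
Qed.

End GammaExistence.

Section Chain.
Variables (Gam : nat -> sgraph) (p q : forall n, Gam n).

(* The chain of the vertex sets of Gam n, n >= 1, with q n identified with
   p n.+1. For p n != q n each class has exactly one representative (n, v) with
   v != q n, namely (n.+1, p n.+1) for the class of (n, q n). *)
Definition chain : Type :=
  {x : {n : nat & Gam n} | (0 < tag x)%N && (tagged x != q (tag x))}.

Definition chain_dist_lt (x y : {n : nat & Gam n}) : nat :=
  (tag x * gdist (tagged x) (q (tag x))
   + \sum_((tag x).+1 <= k < tag y) k * 2 ^ k
   + tag y * gdist (p (tag y)) (tagged y))%N.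

Definition chain_dist (x y : chain) : nat :=
  let: a := val x in let: b := val y in
  if (tag a < tag b)%N then chain_dist_lt a b
  else if (tag b < tag a)%N then chain_dist_lt b a
  else (tag a * gdist (tagged a) (tagged_as a b))%N.

End Chain.

From mathcomp Require Import all_classical all_reals all_analysis.

Local Open Scope classical_set_scope.
Local Open Scope card_scope.
Local Open Scope ring_scope.

Section Metric.
Variable R : realType.

Definition bounded_geometry (X : Type) (d : X -> X -> R) : Prop :=
  forall r : R, 0 < r -> exists N : nat,
    forall x : X, [set y | d x y <= r] #<= `I_N.

Definition cball (Y : metricType R) (x : Y) (r : R) : set Y :=
  [set z | mdist x z <= r].

(* Supremum in [0, +oo], so that the diameter of the empty set is 0. *)
Definition diam (Y : metricType R) (A : set Y) : \bar R :=
  ereal_sup ([set 0%:E] `|` [set (mdist z.1 z.2)%:E | z in A `*` A]).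

Definition round_ball (Y : metricType R) : Prop :=
  forall e : R, 0 < e -> exists2 delta : R, 0 < delta &
    forall x y : Y, x != y ->
      (diam (cball x ((1 + delta) / 2 * mdist x y)
             `&` cball y ((1 + delta) / 2 * mdist x y))
       < (e * mdist x y)%:E)%E.

Definition qi_embedding (X Y : Type) (dX : X -> X -> R) (dY : Y -> Y -> R)
    (f : X -> Y) : Prop :=
  exists L C : R, [/\ 0 < L, 0 <= C & forall x y : X,
    L^-1 * dX x y - C <= dY (f x) (f y) <= L * dX x y + C].

End Metric.

(* Main.v *)
(** A ball of radius r about a point of V_n with n > r + 1 is a singleton, and
    the remaining balls of radius r lie in a fixed finite part of V: this is
    bounded geometry.

    For n large, a quasi-isometric embedding of V restricts to a bilipschitz
    embedding g of Gamma_n whose distortion does not depend on n. Let a, b be a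
    primary pair of Gamma_(k+1) and m, m' the other two gluing vertices. If the
    images of the four sides of the 4-cycle a, m, b, m' all had length at most
    (1 + delta)/2 d(g a, g b), the round ball condition would make d(g m, g m')
    too small. So on one of the sides, i.e. on the primary pair of a copy of
    Gamma_k, g stretches by a factor 1 + delta more than on a, b. Iterating down
    to Gamma_0 gives an edge stretched (1 + delta)^n times more than the primary
    pair of Gamma_n, which contradicts the bounded distortion. *)

Require Import Defs.
From HB Require Import structures.
From mathcomp Require Import all_boot all_order all_algebra.
From mathcomp Require Import zify ring lra.
From mathcomp Require Import all_classical all_reals all_analysis.

Set Implicit Arguments.
Unset Strict Implicit.
Unset Printing Implicit Defensive.

Import Order.TTheory GRing.Theory Num.Theory GammaExistence.

Local Notation "i +! k" := (iter k (@ordS 4) i) (at level 20).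

(** * Graph distance and 1-Lipschitz functions *)

Section GraphDistance.
Local Open Scope nat_scope.
Variable G : sgraph.
Implicit Types (x y z : G) (h : G -> nat).

Definition gconnected : Prop :=
  forall x y, exists s, path (@adj G) x s /\ last x s = y.

Definition lip1 h : Prop := forall u v, adj u v -> h v <= (h u).+1.

Lemma has_walkP x y k :
  reflect (exists s, [/\ path (@adj G) x s, last x s = y & size s = k])
          (has_walk x y k).
Proof.
apply: (iffP existsP) => [[s /andP[ps /eqP ls]]|[s [ps ls sk]]].
  by exists s; rewrite size_tuple.
have szs : size s == k by rewrite sk.
by exists (Tuple szs); rewrite /= ps ls eqxx.
Qed.

Lemma gdist_le_size x s : path (@adj G) x s -> gdist x (last x s) <= size s.
Proof.
move=> ps; rewrite /gdist; have [sG|Gs] := ltnP (size s) #|G|; last first.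
  (* Even the junk value #|G| is at most the length of such a walk. *)
  by apply: leq_trans (find_size _ _) _; rewrite size_iota.
rewrite leqNgt; apply/negP => /(before_find 0)/negbT/negP; apply.
by rewrite nth_iota //; apply/has_walkP; exists s.
Qed.

Lemma gdistxx x : gdist x x = 0.
Proof. by apply/eqP; rewrite -leqn0; exact: (@gdist_le_size x [::]). Qed.

Lemma gdist_adj x y : adj x y -> gdist x y <= 1.
Proof. by move=> xy; apply: (@gdist_le_size x [:: y]); rewrite /= xy. Qed.

Lemma gdist_eq0 x y : gdist x y = 0 -> x = y.
Proof.
move=> xy0; have G0 : 0 < #|G| by apply/card_gt0P; exists x.
have hw : has (has_walk x y) (iota 0 #|G|).
  by rewrite has_find size_iota -/(gdist x y) xy0.
have := nth_find 0 hw; rewrite -/(gdist x y) xy0 nth_iota //.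
by case/has_walkP => s [_ <- /size0nil ->].
Qed.

Lemma primary_neq n x y : primary n x y -> x != y.
Proof.
case=> _ _ xyn; apply/eqP => xy; move: xyn; rewrite xy gdistxx.
by have := expn_gt0 2 n; lia.
Qed.

Hypothesis conG : gconnected.

(** Removing repeated vertices from a walk leaves fewer than #|G| edges, so in a connected graph
    [gdist] never takes its junk value. *)
Lemma gdist_walk x y :
  exists s, [/\ path (@adj G) x s, last x s = y & size s = gdist x y].
Proof.
have [s [ps ls]] := conG x y.
have hw : has (has_walk x y) (iota 0 #|G|).
  move: ls; case/shortenP: ps => t pt ut _ lt.
  apply/hasP; exists (size t); last by apply/has_walkP; exists t.
  by rewrite mem_iota /= add0n -[_.+1]/(size (x :: t)) -(card_uniqP ut) max_card.
have := nth_find 0 hw; rewrite nth_iota; last first.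
  by move: hw; rewrite has_find size_iota.
by rewrite add0n => /has_walkP.
Qed.

(** Lower bounds on graph distances are obtained from this by exhibiting a suitable [h]. *)
Lemma lip1_gdist h x y : lip1 h -> h y <= h x + gdist x y.
Proof. by move=> lh; have [s [ps <- <-]] := gdist_walk x y; exact: lip_path. Qed.

Lemma gdist_triangle z x y : gdist x y <= gdist x z + gdist z y.
Proof.
have [s [ps ls <-]] := gdist_walk x z; have [t [pt lt <-]] := gdist_walk z y.
rewrite -size_cat -lt -ls -last_cat; apply: gdist_le_size.
by rewrite cat_path ps ls.
Qed.

Lemma lip1_gdistl x : lip1 (gdist x).
Proof. by move=> u v /gdist_adj; have := gdist_triangle u x v; lia. Qed.

Lemma gdist_sym x y : gdist x y = gdist y x.
Proof.
suff le (u v : G) : gdist u v <= gdist v u by apply/eqP; rewrite eqn_leq !le.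
have lip : lip1 (fun w => gdist w v).
  move=> a b ab; have := gdist_triangle a b v.
  by move: ab; rewrite adj_sym => /gdist_adj; lia.
by have := lip1_gdist v u lip; rewrite gdistxx add0n.
Qed.

(** Gives access to the maps [pr], which take a proof of [inv]. The distance from [x] is cut off at
    2 ^ n because [inv] asks for a function with that bound. *)
Lemma primary_inv n x y : primary n x y -> inv n x y.
Proof.
case=> vx vy xyn; split=> //; first by rewrite -xyn; exact: gdist_walk.
exists (fun v => minn (2 ^ n) (gdist x v)); split.
- by rewrite gdistxx minn0.
- by rewrite xyn minnn.
- by move=> v; rewrite geq_minl.
- by move=> u v /(@lip1_gdistl x); lia.
Qed.

End GraphDistance.

(** * Distances, valences and primary pairs in a cycle of four copies *)

Lemma pr_surj n (G : sgraph) (p q : G) (I : inv n p q) (x : cyc4 p q) :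
  exists i v, v != q /\ x = pr I i v.
Proof.
case: x => -[i v] /= vq; exists i, v; split=> //.
by apply: val_inj; rewrite /= /cyc4_repr /= (negbTE vq).
Qed.

Section FourCycleDistance.
Local Open Scope nat_scope.
Variables (n : nat) (G : sgraph) (p q : G).
Hypotheses (conG : gconnected G) (pqn : primary n p q).
Let I := primary_inv conG pqn.

Lemma cyc4_glue i : pr I i q = pr I (ordS i) p.
Proof. exact: pr_q. Qed.

Lemma cyc4_connected : gconnected (cyc4 p q).
Proof.
pose C (x y : cyc4 p q) := exists s, path (@adj (cyc4 p q)) x s /\ last x s = y.
have Ctr x y z : C x y -> C y z -> C x z.
  move=> [s [ps ls]] [t [pt lt]]; exists (s ++ t).
  by rewrite cat_path ps last_cat ls pt.
have Cpr i u v : C (pr I i u) (pr I i v).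
  have [s [ps <-]] := conG u v; exists (map (pr I i) s).
  by rewrite last_map; split=> //; exact: pr_path.
have Cglue i k : C (pr I i p) (pr I (i +! k) p).
  elim: k => [|k IH]; first exact: Cpr.
  by apply: Ctr IH _; rewrite iterS -cyc4_glue; exact: Cpr.
have iterP (i j : 'I_4) : exists k, i +! k = j.
  (* Adding 4 keeps the subtraction in [nat] exact; four extra steps return to the same copy. *)
  exists (j + 4 - i); apply: val_inj.
  by case: i j => -[|[|[|[|]]]] // ? [[|[|[|[|]]]]].
move=> x y; have [i [u [_ ->]]] := pr_surj I x; have [j [v [_ ->]]] := pr_surj I y.
have [k <-] := iterP i j.
exact: Ctr (Ctr _ _ _ (Cpr i u p) (Cglue i k)) (Cpr _ _ _).
Qed.

(** A vertex that is not glued has all its edges in its own copy, so gluing adds no neighbour to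
    it. *)
Lemma valence_cyc4 : (forall v : G, valence v <= 2 ^ n) ->
  forall i v, v != q -> v != p -> valence (pr I i v) <= 2 ^ n.
Proof.
move=> val_le i v vq vp; apply: leq_trans (val_le v).
rewrite -[leqRHS](card_imset _ (@pr_inj _ _ _ _ I i)).
apply/subset_leq_card/fintype.subsetP => y.
rewrite !inE => /(@adjP _ _ _ _ I)[j [a [b [ab e ->]]]].
have := congr1 val e; rewrite /= /cyc4_repr /= (negbTE vq).
case: (eqVneq a q) => [_ [_ vep]|_ [ij va]]; first by rewrite vep eqxx in vp.
by rewrite ij; apply: imset_f; rewrite inE va.
Qed.

Lemma valence_cyc4_le : (forall v : G, valence v <= 2 ^ n) ->
  forall x : cyc4 p q, valence x <= 2 ^ n.+1.
Proof.
move=> val_le x; have [i [v [vq ->]]] := pr_surj I x.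
have [->|vp] := eqVneq v p; last first.
  by apply: leq_trans (valence_cyc4 val_le i vq vp) _; rewrite leq_exp2l.
(* [val_glue] speaks of successor indices; [i] is the successor of [i +! 3]. *)
have [j ->] : exists j, i = ordS j.
  by exists (i +! 3); apply: val_inj; case: i => -[|[|[|[|]]]].
by rewrite val_glue.
Qed.

(** Functions that agree at the glued vertices descend to the quotient, and the Lipschitz condition
    is checked copy by copy since each edge lies in one copy. *)
Lemma lip1_cyc4 (phi : 'I_4 -> G -> nat) :
  (forall i, lip1 (phi i)) -> (forall i, phi i q = phi (ordS i) p) ->
  exists h : cyc4 p q -> nat, lip1 h /\ forall i v, h (pr I i v) = phi i v.
Proof.
move=> lip glue; pose h (x : cyc4 p q) := phi (val x).1 (val x).2.
have hE i v : h (pr I i v) = phi i v.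
  by rewrite /h /= /cyc4_repr /=; case: eqP => //= ->; rewrite glue.
exists h; split=> // x y /(@adjP _ _ _ _ I)[i [u [v [uv -> ->]]]].
by rewrite !hE; exact: lip.
Qed.

Lemma gdist_pr_le i u v : gdist (pr I i u) (pr I i v) <= gdist u v.
Proof.
have [s [ps <- <-]] := gdist_walk conG u v.
by rewrite -last_map -(size_map (pr I i)); apply: gdist_le_size; exact: pr_path.
Qed.

(* On the three other copies the distance from u in copy i is interpolated
   between its values at q and p, which differ by at most d(p, q) = 2 ^ n. *)
Lemma gdist_pr i u v : gdist (pr I i u) (pr I i v) = gdist u v.
Proof.
apply/eqP; rewrite eqn_leq gdist_pr_le /=.
case: pqn => _ _ dpq; pose a := gdist u q; pose b := gdist u p.
pose phi (j : 'I_4) w := match (j + 4 - i) %% 4 with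
  | 0 => gdist u w
  | 1 => if a <= b then minn b (a + gdist p w) else maxn b (a - gdist p w)
  | _ => b end.
have tri1 := gdist_triangle conG p u q; have tri2 := gdist_triangle conG q u p.
rewrite (gdist_sym conG q p) in tri2.
have lip j : lip1 (phi j).
  move=> w z wz; rewrite /phi; have := lip1_gdistl conG u wz.
  have := lip1_gdistl conG p wz; move: wz; rewrite adj_sym => wz.
  have := lip1_gdistl conG p wz.
  by case: (_ %% 4) => [|[|?]]; case: (leqP a b); lia.
have glue j : phi j q = phi (ordS j) p.
  rewrite /phi; have := gdistxx p; rewrite -/a -/b in tri1 tri2 *.
  case: {lip phi} i j => -[|[|[|[|]]]] // ? [[|[|[|[|]]]] // ?]; rewrite /= /modn /=;
  by case: (leqP a b); lia.
have [h [hl hE]] := lip1_cyc4 lip glue.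
have := lip1_gdist cyc4_connected (pr I i u) (pr I i v) hl.
by rewrite !hE /phi addnC addnK modnn gdistxx.
Qed.

(** The Lipschitz height [phi] climbs from 0 to 2 ^ n.+1 through copies [i] and [i +! 1], then
    descends back to 0 through the other two. *)
Lemma gdist_glue_opposite i : 2 ^ n.+1 <= gdist (pr I i p) (pr I (i +! 2) p).
Proof.
case: pqn => _ _ dpq.
pose d w := minn (2 ^ n) (gdist p w).
pose phi (j : 'I_4) w := match (j + 4 - i) %% 4 with
  | 0 => d w | 1 => 2 ^ n + d w | 2 => 2 ^ n.+1 - d w | _ => 2 ^ n - d w end.
have lip j : lip1 (phi j).
  move=> w z wz; rewrite /phi /d expnS.
  have := lip1_gdistl conG p wz; move: wz; rewrite adj_sym => wz.
  have := lip1_gdistl conG p wz.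
  by case: (_ %% 4) => [|[|[|?]]]; lia.
have glue j : phi j q = phi (ordS j) p.
  rewrite /phi /d gdistxx dpq minnn minn0 expnS.
  by case: {lip phi} i j => -[|[|[|[|]]]] // ? [[|[|[|[|]]]] // ?]; rewrite /= /modn /=; lia.
have [h [hl hE]] := lip1_cyc4 lip glue.
have := lip1_gdist cyc4_connected (pr I i p) (pr I (i +! 2) p) hl.
rewrite !hE /phi /d gdistxx minn0.
by case: {lip phi glue h hl hE} i => -[|[|[|[|]]]] // ?; rewrite /= /modn /= ?subn0 ?add0n.
Qed.

(** Only gluing vertices have valence above 2 ^ n, and equal or consecutive ones are at distance at
    most 2 ^ n, so a primary pair consists of opposite gluing vertices. *)
Lemma primary_cyc4 : (forall v : G, valence v <= 2 ^ n) ->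
  forall x y : cyc4 p q, primary n.+1 x y ->
  exists i, x = pr I i p /\ y = pr I (i +! 2) p.
Proof.
move=> val_le x y [vx vy dxy]; case: (pqn) => _ _ dpq.
have glueP z : valence z = 2 ^ n.+1 -> exists i, z = pr I i p.
  have [i [v [vq ->]]] := pr_surj I z; have [->|vp] := eqVneq v p; first by exists i.
  have := valence_cyc4 val_le i vq vp; rewrite expnS.
  by have := expn_gt0 2 n; lia.
have [i xi] := glueP x vx; have [j yj] := glueP y vy; exists i; split=> //.
have side k : gdist (pr I k p) (pr I (ordS k) p) <= 2 ^ n.
  by rewrite -dpq -cyc4_glue; exact: gdist_pr_le.
have n0 := expn_gt0 2 n; rewrite expnS in dxy.
have ij : j <> i by move=> ji; move: dxy; rewrite xi yj ji gdistxx; lia.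
have ij1 : j <> ordS i.
  by move=> ji; move: dxy; rewrite xi yj ji; have := side i; lia.
have ij3 : i <> ordS j.
  move=> ji; move: dxy; rewrite xi yj ji (gdist_sym cyc4_connected).
  by have := side j; lia.
rewrite yj; congr (pr I _ p); apply: val_inj => {xi yj}.
case: i j ij ij1 ij3 => -[|[|[|[|]]]] // ? [[|[|[|[|]]]] // ?] //= ij ij1 ij3;
  by [case: ij; apply: val_inj | case: ij1; apply: val_inj | case: ij3; apply: val_inj].
Qed.

End FourCycleDistance.

Lemma is_Gamma_connected_valence n (G : sgraph) : is_Gamma n G ->
  gconnected G /\ forall v : G, (valence v <= 2 ^ n)%N.
Proof.
elim=> {n G} [|n G p q _ [conG valG] pqn].
  split=> [x y|v]; last first.
    case: inv0 => vf vt _ _.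
    by case: v; rewrite ?vf ?vt.
  have [->|xy] := eqVneq x y; first by exists [::].
  by exists [:: y]; split=> //=; rewrite andbT.
split; first exact: cyc4_connected conG pqn.
exact: valence_cyc4_le conG pqn valG.
Qed.

Local Open Scope classical_set_scope.
Local Open Scope ring_scope.

(** * Stretching of bilipschitz maps into a round ball space *)

Lemma mdist_lt_diam (R : realType) (Y : metricType R) (S : set Y) (c : R) (x y : Y) :
  (diam S < c%:E)%E -> S x -> S y -> mdist x y < c.
Proof.
move=> Sc Sx Sy; rewrite -lte_fin; apply: le_lt_trans Sc.
by apply: ereal_sup_ubound; right; exists (x, y).
Qed.

Section Stretching.
Variables (R : realType) (Y : metricType R) (A B e delta : R).
Hypotheses (A_gt0 : 0 < A) (e_ge0 : 0 <= e) (eB_le : e * B <= A).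
Hypothesis delta_gt0 : 0 < delta.
Hypothesis round : forall x y : Y, x != y ->
  (diam (cball x ((1 + delta) / 2 * mdist x y)
         `&` cball y ((1 + delta) / 2 * mdist x y)) < (e * mdist x y)%:E)%E.

Definition bilipschitz (G : sgraph) (g : G -> Y) : Prop := forall u v,
  A * (gdist u v)%:R <= mdist (g u) (g v) <= B * (gdist u v)%:R.

(* If all four sides were short, both midpoints m, m' would lie in the lens
   between the endpoints, which is too thin for their distance. *)
Lemma long_side n (G : sgraph) (p q : G) (conG : gconnected G)
    (pqn : primary n p q) (g : cyc4 p q -> Y) (i : 'I_4) :
  let I := primary_inv conG pqn in
  bilipschitz g ->
  gdist (pr I i p) (pr I (i +! 2) p) = (2 ^ n.+1)%N ->
  exists j, (1 + delta) / 2 * mdist (g (pr I i p)) (g (pr I (i +! 2) p))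
    < mdist (g (pr I j p)) (g (pr I j q)).
Proof.
move=> I bg dist_i; set x := g _; set y := g _.
have /andP[Axy xyB] := bg (pr I i p) (pr I (i +! 2) p).
rewrite -/x -/y dist_i in Axy xyB.
have xy : x != y.
  by rewrite -mdist_gt0; apply: lt_le_trans Axy; rewrite mulr_gt0 ?ltr0n ?expn_gt0.
apply: contrapT => /forallNP short.
have side j : mdist (g (pr I j p)) (g (pr I (ordS j) p)) <= (1 + delta) / 2 * mdist x y.
  by rewrite -cyc4_glue leNgt; apply/negP/short.
have S4 : ordS (i +! 3) = i.
  by apply: val_inj; case: i {dist_i x y Axy xyB xy short side} => -[|[|[|[|]]]].
pose m := g (pr I (i +! 1) p); pose m' := g (pr I (i +! 3) p).
have := mdist_lt_diam (x := m) (y := m') (round xy); set lens := _ `&` _.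
have mP : lens m.
  split; first exact: side i.
  by rewrite /cball /= metric_sym; exact: (side (i +! 1)).
have m'P : lens m'.
  split; last exact: (side (i +! 2)).
  rewrite /cball /= metric_sym; have := side (i +! 3).
  by rewrite S4.
move=> /(_ mP m'P); apply/negP; rewrite -leNgt.
have /andP[Amm _] := bg (pr I (i +! 1) p) (pr I (i +! 3) p).
(* The lens has width below e d(x, y) <= e B 2 ^ n.+1 <= A 2 ^ n.+1, while [m] and [m'] are at least
   A 2 ^ n.+1 apart. *)
apply: le_trans Amm; apply: le_trans (ler_wpM2l e_ge0 xyB) _.
rewrite mulrA; apply: le_trans (ler_wpM2r _ eB_le) _ => //.
by rewrite ler_pM2l // ler_nat; exact: gdist_glue_opposite.
Qed.

(** Copies embed isometrically by [gdist_pr], so restricting [g] to the copy with the long side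
    keeps A and B. Each level then costs a factor of at most 2 / (1 + delta), written without
    division. *)
Lemma stretched_edge n (G : sgraph) : is_Gamma n G ->
  forall (p q : G) (g : G -> Y), primary n p q -> bilipschitz g ->
  exists u v, adj u v /\
    (1 + delta) ^+ n * mdist (g p) (g q) <= 2 ^+ n * mdist (g u) (g v).
Proof.
elim=> {n G} [|n G p q GG IH pqn] x y g xyn bg.
  exists x, y; split; first exact: primary_neq xyn.
  by rewrite !expr0.
have [conG valG] := is_Gamma_connected_valence GG.
have [i [xi yi]] := primary_cyc4 conG pqn valG xyn.
have [_ _] := xyn; rewrite xi yi => /(long_side bg)[j sidej].
pose I := primary_inv conG pqn.
have bgj : bilipschitz (g \o pr I j).
  move=> u v; by rewrite -(gdist_pr conG pqn j u v); exact: bg.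
have [u [v [uv guv]]] := IH p q _ pqn bgj.
exists (pr I j u), (pr I j v); split; first exact: pr_adj.
rewrite [2 ^+ _]exprS -mulrA; apply: le_trans (ler_wpM2l _ guv) => //.
set D := mdist _ _ in sidej *.
have -> : (1 + delta) ^+ n.+1 * D = 2 * ((1 + delta) ^+ n * ((1 + delta) / 2 * D)).
  by rewrite exprS; field.
by rewrite !ler_wpM2l ?exprn_ge0 ?addr_ge0 ?ltW.
Qed.

End Stretching.

(** * Distances in the chain and bounded geometry *)

Section ChainGeometry.
Local Open Scope nat_scope.
Variables (Gam : nat -> sgraph) (p q : forall n, Gam n).

Lemma chain_copy n : gconnected (Gam n) -> 0 < n -> p n.+1 != q n.+1 ->
  exists emb : Gam n -> chain q,
    forall u v, chain_dist p (emb u) (emb v) = n * gdist u v.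
Proof.
move=> conn n0 pq1; pose y0 : chain q := exist _ (Tagged Gam (p n.+1)) pq1.
(* The default of [insubd] is taken exactly at [q n], whose class is represented by [y0]. *)
pose emb (v : Gam n) : chain q := insubd y0 (Tagged Gam v).
have embE v : v != q n -> val (emb v) = Tagged Gam v.
  by move=> vq; rewrite /emb insubdK // unfold_in /= n0.
have embq : val (emb (q n)) = Tagged Gam (p n.+1).
  by rewrite /emb val_insubd /= eqxx andbF.
exists emb => u v; rewrite /chain_dist.
have [->|uq] := eqVneq u (q n); have [->|vq] := eqVneq v (q n).
- by rewrite embq ltnn tagged_asE !gdistxx !muln0.
- rewrite embq embE // ltnNge leqW //= ltnSn /chain_dist_lt /= big_geq //.
  by rewrite gdistxx muln0 !addn0 gdist_sym.
- by rewrite embq embE // ltnSn /chain_dist_lt /= big_geq // gdistxx muln0 !addn0.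
- by rewrite !embE // ltnn tagged_asE.
Qed.

(** The first summand is at least [tag a] since [a] is not the end of its copy. If the tags are not
    consecutive, the last term of the sum is at least [(tag b).-1]. *)
Lemma chain_dist_lt_ge (a b : {n : nat & Gam n}) :
  tag a < tag b -> tagged a != q (tag a) ->
  tag a <= chain_dist_lt p q a b /\ (tag b).-1 <= chain_dist_lt p q a b.
Proof.
move=> ab aq; rewrite /chain_dist_lt.
have gt0 : 0 < gdist (tagged a) (q (tag a)).
  by rewrite lt0n; apply: contra aq => /eqP/gdist_eq0/eqP.
have first_ge : tag a <= tag a * gdist (tagged a) (q (tag a)) by rewrite leq_pmulr.
split; first by lia.
apply: leq_trans (leq_addr _ _); case: (tag b) ab => // m; rewrite ltnS /= => am.
move: am; rewrite leq_eqVlt => /predU1P[<-|am]; first by lia.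
rewrite big_nat_recr //=; have : m <= m * 2 ^ m by rewrite leq_pmulr // expn_gt0.
by lia.
Qed.

(** Distinct points of one copy are at distance at least their tag, points of different copies at
    least the larger tag minus 1; hence [r.+1]. *)
Lemma chain_dist_isolated r (x y : chain q) :
  r.+1 < tag (val x) -> chain_dist p x y <= r -> x = y.
Proof.
rewrite /chain_dist; case: x y => [a a0] [b b0]; rewrite ![val _]/= => ra dr.
apply: val_inj => /=; case/andP: a0 b0 => a0 aq /andP[b0 bq].
move: dr; case: ltnP => [ab|ba]; first by case: (chain_dist_lt_ge ab aq); lia.
case: ltnP => [ba'|ab]; first by case: (chain_dist_lt_ge ba' bq); lia.
case: a b {a0 b0 aq bq} ra ba ab => [n u] [m v] /= rn mn nm.
have nm' : n = m by lia.
case: m / nm' v {mn nm} => v; rewrite tagged_asE => nr.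
suff /gdist_eq0 -> : gdist u v = 0 by [].
apply/eqP; rewrite -leqn0 leqNgt; apply/negP => gt0.
by have := leq_pmulr n gt0; lia.
Qed.

Lemma chain_dist_tag r (x y : chain q) :
  tag (val x) <= r.+1 -> chain_dist p x y <= r -> tag (val y) <= r.+1.
Proof.
rewrite /chain_dist; case: x y => [a a0] [b b0]; rewrite ![val _]/= => ra.
case/andP: a0 => a0 aq; case: ltnP => [ab|ba _]; last by lia.
by case: (chain_dist_lt_ge ab aq); lia.
Qed.

Lemma finite_chain_tag M : finite_set [set y : chain q | (tag (val y) <= M)%N].
Proof.
pose g (t : {i : 'I_M.+1 & Gam i}) : {n & Gam n} := Tagged Gam (tagged t).
apply: (@sub_finite_set _ _ (val @^-1` range g)).
  move=> y /=; rewrite -ltnS; case: (val y) => n v /= nM.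
  by exists (Tagged (fun i : 'I_M.+1 => Gam i) (v : Gam (Ordinal nM))).
apply: finite_preimage; first by move=> a b _ _; exact: val_inj.
by apply: finite_image; exact: finite_finset.
Qed.

End ChainGeometry.

Lemma chain_bounded_geometry (R : realType) (Gam : nat -> sgraph)
    (p q : forall n, Gam n) :
  bounded_geometry (fun x y : chain q => (chain_dist p x y)%:R : R).
Proof.
move=> r r0; pose k := Num.bound r.
have dist_le x y : (chain_dist p x y)%:R <= r -> (chain_dist p x y <= k)%N.
  by move=> /le_lt_trans/(_ (archi_boundP (ltW r0))); rewrite ltr_nat => /ltnW.
have /finite_setP[N FN] := finite_chain_tag q k.+1.
(* [N.+1] dominates both N, for centres with tag at most [k.+1], and 1, for the singleton balls
   further out. *)
exists N.+1 => x; have [xk|kx] := leqP (tag (val x)) k.+1.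
  apply: (@card_le_trans _ _ _ `I_N); last by rewrite card_le_II.
  move: FN; rewrite card_eq_le => /andP[FN _]; apply: card_le_trans FN.
  by apply: subset_card_le => y /= /dist_le; exact: chain_dist_tag.
apply: (@card_le_trans _ _ _ `I_1); last by rewrite card_le_II.
have := @card_set1 _ x; rewrite card_eq_le => /andP[x1 _]; apply: card_le_trans x1.
by apply: subset_card_le => y /= /dist_le /(chain_dist_isolated kx) ->.
Qed.

(** * Exponential stretching against bounded distortion *)

Lemma bernoulli_ineq (R : realDomainType) (x : R) n :
  0 <= x -> 1 + n%:R * x <= (1 + x) ^+ n.
Proof.
move=> x0; elim: n => [|n IH]; first by rewrite mul0r addr0 expr0.
rewrite exprS; apply: le_trans (ler_wpM2l _ IH); last by rewrite addr_ge0.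
have : 0 <= n%:R * x * x by rewrite !mulr_ge0.
by rewrite -[n.+1]addn1 natrD; lra.
Qed.

Theorem mainTheorem2 (R : realType) (Gam : nat -> sgraph)
    (p q : forall n : nat, Gam n)
    (HGam : forall n : nat, is_Gamma n (Gam n))
    (Hpq : forall n : nat, (1 <= n)%N -> primary n (p n) (q n)) :
  let dV := fun x y : chain q => (chain_dist p x y)%:R : R in
  bounded_geometry dV /\
  forall Y : metricType R, round_ball Y ->
    ~ exists f : chain q -> Y, qi_embedding dV (fun a b : Y => mdist a b) f.
Proof.
move=> dV; split; first exact: chain_bounded_geometry.
move=> Y roundY [f [L [C [L0 C0 qi]]]].
have LC0 : 0 < L + C by rewrite ltr_wpDr.
(* K will be the distortion B / A of the restriction to every large copy. It does not depend on n,
   so delta can be fixed before n. *)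
pose K := 2 * L * (L + C); have K0 : 0 < K by rewrite !mulr_gt0.
have Kinv0 : 0 < K^-1 by rewrite invr_gt0.
have [delta d0 round] := roundY _ Kinv0.
have LC_ge0 : 0 <= 2 * L * C by rewrite !mulr_ge0 // ltW.
have Kd_ge0 : 0 <= K / delta by rewrite divr_ge0 ?ltW.
(* Two demands on n: n >= 2 L C absorbs the additive constant, and n delta > K defeats the
   distortion K. *)
pose n := (Num.bound (2 * L * C + K / delta)).+1.
have nbig : 2 * L * C + K / delta < n%:R.
  apply: lt_le_trans (archi_boundP _) _; last by rewrite ler_nat.
  exact: addr_ge0.
have n_ge : 2 * L * C <= n%:R.
  by apply: le_trans (ltW nbig); rewrite lerDl.
have n_gt : K < n%:R * delta.
  rewrite -ltr_pdivrMr //; apply: le_lt_trans nbig.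
  by rewrite lerDr.
have n1 : (0 < n)%N by [].
move: n nbig n_ge n_gt n1 => n _ n_ge n_gt n1.
have [conn _] := is_Gamma_connected_valence (HGam n).
have [emb embE] := chain_copy conn n1 (primary_neq (Hpq n.+1 isT)).
(* A is half of n / L, the other half absorbing the subtracted C. B absorbs the added C because
   distinct vertices of copy n are at distance at least n >= 1. *)
pose A := n%:R / (2 * L); pose B := (L + C) * n%:R.
have n0 : 0 < n%:R :> R by rewrite ltr0n.
have A0 : 0 < A by rewrite divr_gt0 ?mulr_gt0.
have eB : K^-1 * B <= A.
  suff -> : K^-1 * B = A by [].
  by rewrite /K /A /B; field; rewrite !gt_eqF.
have CA : C <= A by rewrite /A ler_pdivlMr ?mulr_gt0 // mulrC.
have bg : bilipschitz A B (f \o emb).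
  move=> u v /=; have [->|uv] := eqVneq u v.
    by rewrite gdistxx mdistxx !mulr0 lexx.
  have := qi (emb u) (emb v); rewrite /dV embE natrM.
  have d1 : (0 < gdist u v)%N.
    by rewrite lt0n; apply: contra uv => /eqP/gdist_eq0/eqP.
  have CAd : C <= A * (gdist u v)%:R.
    by apply: le_trans CA _; rewrite ler_peMr ?ler1n // ltW.
  have CBd : C <= C * n%:R * (gdist u v)%:R.
    by rewrite -mulrA ler_peMr // -natrM ler1n muln_gt0 n1.
  have AE : L^-1 * (n%:R * (gdist u v)%:R) = 2 * (A * (gdist u v)%:R).
    by rewrite /A; field; rewrite gt_eqF.
  rewrite AE => /andP[lo hi]; apply/andP; split; first by lra.
  by apply: le_trans hi _; rewrite /B; lra.
have [u [v [uv]]] := stretched_edge A0 (ltW Kinv0) eB d0 round (HGam n) (Hpq n n1) bg.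
have /andP[lo _] := bg (p n) (q n); have /andP[_ hi] := bg u v.
have [_ _ dpq] := Hpq n n1; rewrite dpq natrX in lo.
have B0 : 0 < B by rewrite mulr_gt0.
have {}hi : mdist (f (emb u)) (f (emb v)) <= B.
  apply: le_trans hi _; rewrite -[leRHS]mulr1 ler_pM2l //.
  by rewrite (@ler_nat R _ 1) gdist_adj.
(* The stretched edge has image length at most B = K A and the primary pair at least A 2 ^ n, which
   would force (1 + delta) ^ n <= K, against Bernoulli. *)
apply/negP; rewrite -ltNge /=.
apply: le_lt_trans (ler_wpM2l _ hi) _; first by rewrite exprn_ge0.
apply: lt_le_trans (ler_wpM2l _ lo); last by rewrite exprn_ge0 // addr_ge0 // ltW.
have bern := bernoulli_ineq n (ltW d0).
have KA : B = K * A by rewrite /K /A /B; field; rewrite gt_eqF.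
have -> : (1 + delta) ^+ n * (A * 2 ^+ n) = 2 ^+ n * ((1 + delta) ^+ n * A) by ring.
rewrite KA ltr_pM2l ?exprn_gt0 // ltr_pM2r //.
by lra.
Qed.
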